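(* Let $\mathbb{F}$ be an algebraically closed field with $\mathrm{Char}(\mathbb{F})\neq 2,3$, let $I$ denote the $2\times 2$ identity matrix, and let $A_1(\alpha_1,\alpha_2,\alpha_4,\beta_1),\dots,A_{12}$ be the $2$-dimensional algebras over $\mathbb{F}$ given by the matrices of structure constants listed in the context. Then, for all values of the parameters $\alpha_1,\alpha_2,\alpha_4,\beta_1,\beta_2\in\mathbb{F}$ (subject to the restrictions indicated), the automorphism groups are: \begin{itemize} \item $Aut(A_1(\alpha_1,\alpha_2,\alpha_4,\beta_1))=\{I\}$; \item $Aut(A_2(\alpha_1,\beta_1,\beta_2))=\{I\}$ if $\beta_1\neq 0$, and $Aut(A_2(\alpha_1,0,\beta_2))=\left\{I,\begin{pmatrix}1&0\\0&-1\end{pmatrix}\right\}$; \item $Aut(A_3(\beta_1,\beta_2))=\{I\}$; \item $Aut(A_4(\alpha_1,\beta_2))=\left\{\begin{pmatrix}1&0\\0&d\end{pmatrix}: d\in\mathbb{F},\ d\neq 0\right\}$ if $\beta_2\neq 2\alpha_1-1$; \item $Aut(A_4(\alpha_1,2\alpha_1-1))=\left\{\begin{pmatrix}1&0\\c&d\end{pmatrix}: c,d\in\mathbb{F},\ d\neq 0\right\}$; \item $Aut(A_5(\alpha_1))=\left\{\begin{pmatrix}1&0\\c&1\end{pmatrix}: c\in\mathbb{F}\right\}$; \item $Aut(A_6(\alpha_1,\beta_1))=\{I\}$ if $\beta_1\neq 0$, and $Aut(A_6(\alpha_1,0))=\left\{I,\begin{pmatrix}1&0\\0&-1\end{pmatrix}\right\}$;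 \item $Aut(A_7(\beta_1))=\{I\}$; \item $Aut(A_8(\alpha_1))=\left\{\begin{pmatrix}1&0\\0&d\end{pmatrix}: d\in\mathbb{F},\ d\neq 0\right\}$ if $\alpha_1\neq\frac13$, and $Aut(A_8(\tfrac13))=\left\{\begin{pmatrix}1&0\\c&d\end{pmatrix}: c,d\in\mathbb{F},\ d\neq 0\right\}$; \item $Aut(A_9)=\left\{\begin{pmatrix}1&0\\c&1\end{pmatrix}: c\in\mathbb{F}\right\}$; \item $Aut(A_{10})=\left\{\begin{pmatrix}a&0\\0&1\end{pmatrix}: a\in\mathbb{F},\ a\neq 0\right\}$; \item $Aut(A_{11})=\left\{I,\begin{pmatrix}-1&0\\0&1\end{pmatrix},\begin{pmatrix}\frac12&\frac{\sqrt3}{2}\\ \frac{\sqrt3}{2}&-\frac12\end{pmatrix},\begin{pmatrix}\frac12&-\frac{\sqrt3}{2}\\ -\frac{\sqrt3}{2}&-\frac12\end{pmatrix},\begin{pmatrix}-\frac12&\frac{\sqrt3}{2}\\ -\frac{\sqrt3}{2}&-\frac12\end{pmatrix},\begin{pmatrix}-\frac12&-\frac{\sqrt3}{2}\\ \frac{\sqrt3}{2}&-\frac12\end{pmatrix}\right\}$, where $\sqrt3$ denotes a fixed square root of $3$ in $\mathbb{F}$; \item $Aut(A_{12})=\left\{\begin{pmatrix}a&0\\c&a^2\end{pmatrix}: a,c\in\mathbb{F},\ a\neq 0\right\}$. \end{itemize}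
   Context: An algebra over $\mathbb{F}$ is a vector space with a bilinear multiplication (no associativity, commutativity or unit is assumed). A $2$-dimensional algebra $\mathbb{A}$ with fixed basis $e=(e^1,e^2)$ is identified with its matrix of structure constants (MSC) $A=\begin{pmatrix}\alpha_1&\alpha_2&\alpha_3&\alpha_4\\ \beta_1&\beta_2&\beta_3&\beta_4\end{pmatrix}\in M(2\times 4;\mathbb{F})$, meaning $\mathbf{u}\cdot\mathbf{v}=eA(u\otimes v)$ for $\mathbf{u}=eu$, $\mathbf{v}=ev$ with coordinate column vectors $u,v$. Explicitly, $e^1e^1=\alpha_1e^1+\beta_1e^2$, $e^1e^2=\alpha_2e^1+\beta_2e^2$, $e^2e^1=\alpha_3e^1+\beta_3e^2$, $e^2e^2=\alpha_4e^1+\beta_4e^2$. An automorphism is an invertible linear map $\mathbf{g}$ with $\mathbf{g}(\mathbf{u}\cdot\mathbf{v})=\mathbf{g}(\mathbf{u})\cdot\mathbf{g}(\mathbf{v})$; it is represented by the matrix $g\in GL(2;\mathbb{F})$ with $\mathbf{g}(eu)=egu$, so that $$Aut(A)=\{g\in GL(2;\mathbb{F}): gA-A(g\otimes g)=0\},$$ where for matrices $X=(x_{ij})$ and $Y$, $X\otimes Y$ is the block matrix with blocks $(x_{ij}Y)$. The algebras are (all parameters are arbitrary elements of $\mathbb{F}$): $A_1(\alpha_1,\alpha_2,\alpha_4,\beta_1)=\begin{pmatrix}\alpha_1&\alpha_2&\alpha_2+1&\alpha_4\\ \beta_1&-\alpha_1&-\alpha_1+1&-\alpha_2\end{pmatrix}$;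 $A_2(\alpha_1,\beta_1,\beta_2)=\begin{pmatrix}\alpha_1&0&0&1\\ \beta_1&\beta_2&1-\alpha_1&0\end{pmatrix}$; $A_3(\beta_1,\beta_2)=\begin{pmatrix}0&1&1&0\\ \beta_1&\beta_2&1&-1\end{pmatrix}$; $A_4(\alpha_1,\beta_2)=\begin{pmatrix}\alpha_1&0&0&0\\ 0&\beta_2&1-\alpha_1&0\end{pmatrix}$; $A_5(\alpha_1)=\begin{pmatrix}\alpha_1&0&0&0\\ 1&2\alpha_1-1&1-\alpha_1&0\end{pmatrix}$; $A_6(\alpha_1,\beta_1)=\begin{pmatrix}\alpha_1&0&0&1\\ \beta_1&1-\alpha_1&-\alpha_1&0\end{pmatrix}$; $A_7(\beta_1)=\begin{pmatrix}0&1&1&0\\ \beta_1&1&0&-1\end{pmatrix}$; $A_8(\alpha_1)=\begin{pmatrix}\alpha_1&0&0&0\\ 0&1-\alpha_1&-\alpha_1&0\end{pmatrix}$; $A_9=\begin{pmatrix}\frac13&0&0&0\\ 1&\frac23&-\frac13&0\end{pmatrix}$; $A_{10}=\begin{pmatrix}0&1&1&0\\ 0&0&0&-1\end{pmatrix}$; $A_{11}=\begin{pmatrix}0&1&1&0\\ 1&0&0&-1\end{pmatrix}$; $A_{12}=\begin{pmatrix}0&0&0&0\\ 1&0&0&0\end{pmatrix}$. *)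

(* Defs.v *)
From mathcomp Require Import all_boot all_order all_algebra.
From mathcomp Require Import mxtens.
From mathcomp Require Import classical_sets.

Set Implicit Arguments.
Unset Strict Implicit.
Unset Printing Implicit Defensive.

Import GRing.Theory.
Local Open Scope ring_scope.
Local Open Scope classical_set_scope.

Definition mx22 (F : fieldType) (a b c d : F) : 'M[F]_2 :=
  \matrix_(i, j) (nth [::] [:: [:: a; b]; [:: c; d]] i)`_j.

(* The columns are indexed by 'I_(2 * 2), as for a Kronecker product: the      *)
(* column of index 2 * i + j holds the coordinates of e^(i+1) e^(j+1).         *)
Definition msc (F : fieldType) (a1 a2 a3 a4 b1 b2 b3 b4 : F) :
    'M[F]_(2, 2 * 2) :=
  \matrix_(i, j) (nth [::] [:: [:: a1; a2; a3; a4]; [:: b1; b2; b3; b4]] i)`_j.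

Definition alg_mul (F : fieldType) (A : 'M[F]_(2, 2 * 2)) (u v : 'cV[F]_2) :
    'cV[F]_2 :=
  A *m (u *t v).

(* Lemma AutP below relates this set to the multiplicative invertible linear   *)
(* maps of the algebra.                                                        *)
Definition Aut (F : fieldType) (A : 'M[F]_(2, 2 * 2)) : set 'M[F]_2 :=
  [set g | g \in unitmx /\ g *m A - A *m (g *t g) = 0].

Section Families.
Variable F : fieldType.

Definition A1 (al1 al2 al4 be1 : F) : 'M[F]_(2, 2 * 2) :=
  msc al1 al2     (al2 + 1)   al4
      be1 (- al1) (- al1 + 1) (- al2).

Definition A2 (al1 be1 be2 : F) : 'M[F]_(2, 2 * 2) :=
  msc al1 0   0         1
      be1 be2 (1 - al1) 0.

Definition A3 (be1 be2 : F) : 'M[F]_(2, 2 * 2) :=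
  msc 0   1   1 0
      be1 be2 1 (- 1).

Definition A4 (al1 be2 : F) : 'M[F]_(2, 2 * 2) :=
  msc al1 0   0         0
      0   be2 (1 - al1) 0.

Definition A5 (al1 : F) : 'M[F]_(2, 2 * 2) :=
  msc al1 0             0         0
      1   (2 * al1 - 1) (1 - al1) 0.

Definition A6 (al1 be1 : F) : 'M[F]_(2, 2 * 2) :=
  msc al1 0         0       1
      be1 (1 - al1) (- al1) 0.

Definition A7 (be1 : F) : 'M[F]_(2, 2 * 2) :=
  msc 0   1 1 0
      be1 1 0 (- 1).

Definition A8 (al1 : F) : 'M[F]_(2, 2 * 2) :=
  msc al1 0         0       0
      0   (1 - al1) (- al1) 0.

Definition A9 : 'M[F]_(2, 2 * 2) :=
  msc (1 / 3) 0       0         0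
      1       (2 / 3) (- (1 / 3)) 0.

Definition A10 : 'M[F]_(2, 2 * 2) :=
  msc 0 1 1 0
      0 0 0 (- 1).

Definition A11 : 'M[F]_(2, 2 * 2) :=
  msc 0 1 1 0
      1 0 0 (- 1).

Definition A12 : 'M[F]_(2, 2 * 2) :=
  msc 0 0 0 0
      1 0 0 0.

End Families.

Arguments A9 F : clear implicits.
Arguments A10 F : clear implicits.
Arguments A11 F : clear implicits.
Arguments A12 F : clear implicits.

Lemma mul_delta_tens (F : fieldType) m (M : 'M[F]_(m, 2 * 2)) (i j : 'I_2) :
  M *m ((delta_mx i 0 : 'cV_2) *t (delta_mx j 0 : 'cV_2)) =
  col (mxtens_index (i, j)) M.
Proof.
apply/matrixP => r s; rewrite !mxE (bigD1 (mxtens_index (i, j))) //= big1.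
  by rewrite addr0 !mxE mxtens_indexK !ord1 !eqxx !mulr1.
move=> k; case: (mxtens_indexP k) => i' j' neq; rewrite !mxE mxtens_indexK /=.
rewrite -natrM mulnb andbACA.
case: eqP => [ei|_]; last by rewrite mulr0.
case: eqP => [ej|_]; last by rewrite mulr0.
by rewrite ei ej eqxx in neq.
Qed.

Lemma alg_mul_delta (F : fieldType) (A : 'M[F]_(2, 2 * 2)) (i j : 'I_2) :
  alg_mul A (delta_mx i 0) (delta_mx j 0) = col (mxtens_index (i, j)) A.
Proof. exact: mul_delta_tens. Qed.

Lemma AutP (F : fieldType) (A : 'M[F]_(2, 2 * 2)) (g : 'M[F]_2) :
  Aut A g <->
  g \in unitmx /\
  (forall u v, g *m alg_mul A u v = alg_mul A (g *m u) (g *m v)).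
Proof.
split=> -[gU H]; split=> //.
  move=> u v; rewrite /alg_mul -tensmx_mul !mulmxA.
  by move/subr0_eq: H => ->.
apply/eqP; rewrite subr_eq0; apply/eqP/matrixP => r k.
case: (mxtens_indexP k) => i j.
have := H (delta_mx i 0) (delta_mx j 0).
rewrite /alg_mul -tensmx_mul !mulmxA !mul_delta_tens.
by move/matrixP/(_ r 0); rewrite !mxE.
Qed.

(* Main.v *)
Require Import Defs.
From mathcomp Require Import all_boot all_order all_algebra.
From mathcomp Require Import mxtens classical_sets ring.

Set Implicit Arguments.
Unset Strict Implicit.
Unset Printing Implicit Defensive.

Import GRing.Theory.
Local Open Scope ring_scope.
Local Open Scope classical_set_scope.

(** An automorphism g intertwines multiplications: it carries left
    multiplication by u to left multiplication by g u, and likewise on the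
    right.  Conjugate operators have the same trace, so the two linear forms
    sending u to the trace of left, respectively right, multiplication by u
    are invariant under g ([Aut_ltrace], [Aut_rtrace]).  In coordinates these
    forms are the rows (al1 + be2, al3 + be4) and (al1 + be3, al2 + be4), and
    invariance of a row t reads t *m g = t.

    This is what keeps the computation short.  For A1 the two forms are (0, 1)
    and (1, 0), which forces g = 1.  For A2, ..., A9 one of the two forms is
    (1, 0), so that the first row of g is (1, 0) ([Aut_row1]) and only the
    second row (c, d) is unknown.  Six of these families (A2, A4, A5, A6, A8,
    A9) share the shape e^2 e^2 = al4 e^1, with e^1 e^2 and e^2 e^1 multiples of
    e^2; what remains for them is d != 0, al4 * c = 0, al4 * d ^ 2 = al4 and
    c * (be2 + be3 - al1) = be1 * (d - 1) ([Aut_triangularP]), from which each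
    group is read off according to which coefficients vanish.  For A3 and A7
    the remaining equations are d = 1 and 2 * c = 0.

    Both trace forms vanish on A10, A11 and A12, which are solved by hand from
    the eight coordinate equations ([Aut_mscP]).  The group of A11 is the
    symmetric group on three letters: it permutes the three nonzero idempotents
    -e^2 and (r e^1 + e^2) / 2, where r ^ 2 = 3. *)

(** * Matrices of order two in coordinates *)

Section Mx22.
Variable F : fieldType.
Implicit Types (a b c d : F) (g : 'M[F]_2).

Lemma mx22_eta g : g = mx22 (g 0 0) (g 0 1) (g 1 0) (g 1 1).
Proof.
apply/matrixP=> i j; rewrite mxE.
by case: i => [[|[|//]] i]; case: j => [[|[|//]] j] //=;
  congr (g _ _); apply: val_inj.
Qed.

Lemma mx22_inj a b c d a' b' c' d' :
  mx22 a b c d = mx22 a' b' c' d' <-> [/\ a = a', b = b', c = c' & d = d'].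
Proof.
split=> [/matrixP E | [-> -> -> ->] //].
by move: (E 0 0) (E 0 1) (E 1 0) (E 1 1); rewrite !mxE.
Qed.

Lemma mx22_1 : 1%:M = mx22 1 0 0 1 :> 'M[F]_2.
Proof. by rewrite [LHS]mx22_eta !mxE. Qed.

Lemma mx22D a b c d a' b' c' d' :
  mx22 a b c d + mx22 a' b' c' d' = mx22 (a + a') (b + b') (c + c') (d + d').
Proof. by rewrite [LHS]mx22_eta !mxE. Qed.

Lemma mx22Z k a b c d :
  k *: mx22 a b c d = mx22 (k * a) (k * b) (k * c) (k * d).
Proof. by rewrite [LHS]mx22_eta !mxE. Qed.

Lemma mx22M a b c d a' b' c' d' :
  mx22 a b c d *m mx22 a' b' c' d' =
  mx22 (a * a' + b * c') (a * b' + b * d') (c * a' + d * c') (c * b' + d * d').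
Proof. by rewrite [LHS]mx22_eta !mxE !big_ord_recl !big_ord0 !addr0 !mxE. Qed.

Lemma tr_mx22 a b c d : \tr (mx22 a b c d) = a + d.
Proof. by rewrite /mxtrace !big_ord_recl big_ord0 addr0 !mxE. Qed.

Lemma unitmx22 a b c d : (mx22 a b c d \in unitmx) = (a * d - b * c != 0).
Proof.
rewrite unitmxE unitfE (expand_det_row _ 0) !big_ord_recl big_ord0 /cofactor.
by rewrite !det_mx11 !mxE /= /bump /= expr0 expr1 mul1r mulN1r mulrN addr0.
Qed.

Lemma set22_ext (S T : set 'M[F]_2) :
  (forall a b c d, S (mx22 a b c d) <-> T (mx22 a b c d)) -> S = T.
Proof.
by move=> H; apply/seteqP; split=> g; rewrite (mx22_eta g) => /H.
Qed.

End Mx22.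

(** * Automorphisms in coordinates *)

Section AutCoordinates.
Variables (F : fieldType) (al1 al2 al3 al4 be1 be2 be3 be4 : F).
Let A := msc al1 al2 al3 al4 be1 be2 be3 be4.
Variables a b c d : F.

(** Each clause compares the two coordinates of the image of a product of basis
    vectors with those of the product of the images, for e^1 e^1, e^1 e^2,
    e^2 e^1 and e^2 e^2 in turn. *)
Lemma Aut_mscP : Aut A (mx22 a b c d) <->
  [/\ a * d - b * c != 0,
      a * al1 + b * be1 = al1 * a * a + al2 * a * c + al3 * c * a + al4 * c * c
    /\ c * al1 + d * be1 = be1 * a * a + be2 * a * c + be3 * c * a + be4 * c * c,
      a * al2 + b * be2 = al1 * a * b + al2 * a * d + al3 * c * b + al4 * c * d
    /\ c * al2 + d * be2 = be1 * a * b + be2 * a * d + be3 * c * b + be4 * c * d,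
      a * al3 + b * be3 = al1 * b * a + al2 * b * c + al3 * d * a + al4 * d * c
    /\ c * al3 + d * be3 = be1 * b * a + be2 * b * c + be3 * d * a + be4 * d * c
    & a * al4 + b * be4 = al1 * b * b + al2 * b * d + al3 * d * b + al4 * d * d
    /\ c * al4 + d * be4 = be1 * b * b + be2 * b * d + be3 * d * b + be4 * d * d].
Proof.
rewrite /Aut /mkset unitmx22.
pose col k (lt_k4 : (k < 2 * 2)%N) := Ordinal lt_k4.
have coord r s : (mx22 a b c d *m A - A *m (mx22 a b c d *t mx22 a b c d)) r s
    = \sum_k mx22 a b c d r k * A k s
      - \sum_k A r k * (mx22 a b c d *t mx22 a b c d) k s by rewrite !mxE.
split=> [[gU /matrixP E] | [gU [E11 E21] [E12 E22] [E13 E23] [E14 E24]]].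
  split=> //; [set s := @col 0 isT | set s := @col 1 isT
             | set s := @col 2 isT | set s := @col 3 isT];
  move: (E 0 s) (E 1 s); rewrite !coord !big_ord_recl !big_ord0 !mxE /=;
  by rewrite !addr0 !mulrA !addrA => /subr0_eq-> /subr0_eq->.
split=> //; apply/matrixP=> r s.
rewrite coord !big_ord_recl !big_ord0 !mxE !addr0 !mulrA !addrA.
by case: r => [[|[|//]] r]; case: s => [[|[|[|[|//]]]] s] /=;
  apply/eqP; rewrite subr_eq0; apply/eqP.
Qed.

End AutCoordinates.

Lemma Aut1 (F : fieldType) (A : 'M[F]_(2, 2 * 2)) : Aut A 1%:M.
Proof. by apply/AutP; split=> [|u v]; rewrite ?unitmx1 ?mul1mx. Qed.

(** * Invariance of the trace forms *)

Section Traces.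
Variables (F : fieldType) (al1 al2 al3 al4 be1 be2 be3 be4 : F).
Variables a b c d : F.

(** With L1 and L2 the matrices of left multiplication by e^1 and e^2, the
    automorphism equations say that g L1 g^-1 = a L1 + c L2 and
    g L2 g^-1 = b L1 + d L2; the claim is the equality of traces. *)
Lemma Aut_ltrace : Aut (msc al1 al2 al3 al4 be1 be2 be3 be4) (mx22 a b c d) ->
  (al1 + be2) * a + (al3 + be4) * c = al1 + be2 /\
  (al1 + be2) * b + (al3 + be4) * d = al3 + be4.
Proof.
move=> /Aut_mscP[gU [E11 E21] [E12 E22] [E13 E23] [E14 E24]].
rewrite -unitmx22 in gU; set g := mx22 a b c d in gU.
pose L1 := mx22 al1 al2 be1 be2; pose L2 := mx22 al3 al4 be3 be4.
have conj_tr X Y : g *m X = Y *m g -> \tr Y = \tr X.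
  by move=> gX; rewrite -(mulKmx gU X) gX mxtrace_mulC mulmxK.
have /conj_tr : g *m L1 = (a *: L1 + c *: L2) *m g.
  by rewrite !mx22Z mx22D !mx22M E11 E12 E21 E22; congr mx22; ring.
have /conj_tr : g *m L2 = (b *: L1 + d *: L2) *m g.
  by rewrite !mx22Z mx22D !mx22M E13 E14 E23 E24; congr mx22; ring.
rewrite !mxtraceD !mxtraceZ !tr_mx22 => tr2 tr1.
by split; [rewrite -[RHS]tr1 | rewrite -[RHS]tr2]; ring.
Qed.

(** Exchanging the two middle columns gives the opposite algebra, which has the
    same automorphisms; this transfers results on left multiplications to right
    multiplications. *)
Lemma Aut_opp : Aut (msc al1 al2 al3 al4 be1 be2 be3 be4) (mx22 a b c d) ->
  Aut (msc al1 al3 al2 al4 be1 be3 be2 be4) (mx22 a b c d).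
Proof.
move=> /Aut_mscP[gU [E11 E21] [E12 E22] [E13 E23] [E14 E24]]; apply/Aut_mscP.
by split=> //; split; rewrite ?(E11, E21, E12, E22, E13, E23, E14, E24); ring.
Qed.

End Traces.

Lemma Aut_rtrace (F : fieldType) (al1 al2 al3 al4 be1 be2 be3 be4 a b c d : F) :
  Aut (msc al1 al2 al3 al4 be1 be2 be3 be4) (mx22 a b c d) ->
  (al1 + be3) * a + (al2 + be4) * c = al1 + be3 /\
  (al1 + be3) * b + (al2 + be4) * d = al2 + be4.
Proof. by move/Aut_opp/Aut_ltrace. Qed.

(** Linear combination of equations: to deduce x = y, supply a combination
    l = r of known equations for which x - y = l - r is a ring identity. *)
Lemma eq_sub_eq (V : zmodType) (x y l r : V) : l = r -> x - y = l - r -> x = y.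
Proof. by move=> ->; rewrite subrr => /subr0_eq. Qed.

Section FirstRow.
Variables (F : fieldType) (al1 al2 al3 al4 be1 be2 be3 be4 : F).
Variables a b c d : F.

(** The two alternatives say that the left, respectively right, trace form is
    (1, 0); its invariance determines the first row of g. *)
Lemma Aut_row1 :
  al1 + be2 = 1 /\ al3 + be4 = 0 \/ al1 + be3 = 1 /\ al2 + be4 = 0 ->
  Aut (msc al1 al2 al3 al4 be1 be2 be3 be4) (mx22 a b c d) -> a = 1 /\ b = 0.
Proof.
case=> -[t1 t2]; [move/Aut_ltrace | move/Aut_rtrace];
  by rewrite t1 t2 !mul1r !mul0r !addr0.
Qed.

End FirstRow.

(** * Algebras in which multiplication by e^1 preserves the line of e^2 *)

Section Triangular.
Variables (F : fieldType) (al1 al4 be1 be2 be3 : F).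
(* With al2 = al3 = be4 = 0 both trace forms have second coordinate 0; this
   makes one of them equal to (1, 0). *)
Hypothesis tr1 : al1 + be2 = 1 \/ al1 + be3 = 1.
Let A := msc al1 0 0 al4 be1 be2 be3 0.

(** Given the first row (1, 0), the product e^2 e^2 yields the two conditions
    on al4, and the second coordinate of e^1 e^1 yields the last one. *)
Lemma Aut_triangularP a b c d : Aut A (mx22 a b c d) <->
  [/\ a = 1, b = 0, d != 0 &
      [/\ al4 * c = 0, al4 * d ^+ 2 = al4
        & c * (be2 + be3 - al1) = be1 * (d - 1)]].
Proof.
split=> [gA | [-> -> d0 [al4c al4d e11]]].
  have [a1 b0] : a = 1 /\ b = 0.
    by apply: Aut_row1 gA; case: tr1 => t; [left | right]; rewrite t addr0.
  move/Aut_mscP: gA; rewrite {}a1 {}b0.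
  move=> -[dN0 [_ E21] _ _ [E14 E24]]; split=> //; last split.
  - by rewrite mul1r mul0r subr0 in dN0.
  - by apply: (eq_sub_eq E24); ring.
  - by apply: (eq_sub_eq (esym E14)); ring.
  - by apply: (eq_sub_eq (esym E21)); ring.
apply/Aut_mscP; split; [by rewrite mul1r mul0r subr0 | split..].
- by apply: (eq_sub_eq (congr1 ( *%R (- c)) al4c)); ring.
- by apply: (eq_sub_eq (esym e11)); ring.
- by apply: (eq_sub_eq (congr1 ( *%R (- d)) al4c)); ring.
- by ring.
- by apply: (eq_sub_eq (congr1 ( *%R (- d)) al4c)); ring.
- by ring.
- by apply: (eq_sub_eq (esym al4d)); ring.
- by apply: (eq_sub_eq al4c); ring.
Qed.

End Triangular.

Section TriangularFamilies.
Variable F : fieldType.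
Implicit Types al be : F.

Lemma Aut_triangular_id al1 be1 be2 be3 :
  al1 + be2 = 1 \/ al1 + be3 = 1 -> be1 != 0 ->
  Aut (msc al1 0 0 1 be1 be2 be3 0) = [set 1%:M].
Proof.
move=> tr1 be1N0; apply/seteqP; split=> [g | _ ->]; last exact: Aut1.
rewrite (mx22_eta g) => /(Aut_triangularP _ _ tr1)[-> -> _ [+ _]].
rewrite mul1r => ->; rewrite mul0r => /esym/eqP.
by rewrite mulf_eq0 (negPf be1N0) subr_eq0 /= mx22_1 => /eqP->.
Qed.

Lemma Aut_triangular_sign al1 be2 be3 :
  al1 + be2 = 1 \/ al1 + be3 = 1 ->
  Aut (msc al1 0 0 1 0 be2 be3 0) = [set 1%:M; mx22 1 0 0 (- 1)].
Proof.
move=> tr1; apply: set22_ext => a b c d; split.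
  move=> /(Aut_triangularP _ _ tr1)[-> -> _ [+ + _]].
  rewrite !mul1r => -> /eqP; rewrite sqrf_eq1 /= mx22_1.
  by case/orP=> /eqP->; [left | right].
rewrite /= mx22_1 => -[] /mx22_inj[-> -> -> ->];
  apply/(Aut_triangularP _ _ tr1);
  by split; rewrite ?oppr_eq0 ?oner_eq0 //; split; ring.
Qed.

Lemma Aut_triangular_diag al1 be2 be3 :
  al1 + be2 = 1 \/ al1 + be3 = 1 -> be2 + be3 != al1 ->
  Aut (msc al1 0 0 0 0 be2 be3 0) =
    [set g | exists d : F, d != 0 /\ g = mx22 1 0 0 d].
Proof.
move=> tr1; rewrite -subr_eq0 => sN0; apply: set22_ext => a b c d; split.
  move=> /(Aut_triangularP _ _ tr1)[-> -> dN0 [_ _ /eqP]].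
  by rewrite mul0r mulf_eq0 (negPf sN0) orbF => /eqP->; exists d.
case=> e [eN0 /mx22_inj[-> -> -> ->]].
by apply/(Aut_triangularP _ _ tr1); split; rewrite ?mul0r.
Qed.

Lemma Aut_triangular_full al1 be2 be3 :
  al1 + be2 = 1 \/ al1 + be3 = 1 -> be2 + be3 = al1 ->
  Aut (msc al1 0 0 0 0 be2 be3 0) =
    [set g | exists c d : F, d != 0 /\ g = mx22 1 0 c d].
Proof.
move=> tr1 /eqP; rewrite -subr_eq0 => /eqP s0.
apply: set22_ext => a b c d; split.
  by move=> /(Aut_triangularP _ _ tr1)[-> -> dN0 _]; exists c, d.
case=> e [f [fN0 /mx22_inj[-> -> -> ->]]].
by apply/(Aut_triangularP _ _ tr1); split; rewrite ?mul0r ?s0 ?mulr0.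
Qed.

Lemma Aut_triangular_unipotent al1 be2 be3 :
  al1 + be2 = 1 \/ al1 + be3 = 1 -> be2 + be3 = al1 ->
  Aut (msc al1 0 0 0 1 be2 be3 0) = [set g | exists c : F, g = mx22 1 0 c 1].
Proof.
move=> tr1 /eqP; rewrite -subr_eq0 => /eqP s0.
apply: set22_ext => a b c d; split.
  move=> /(Aut_triangularP _ _ tr1)[-> -> _ [_ _ /esym/eqP]].
  by rewrite s0 mulr0 mul1r subr_eq0 => /eqP->; exists c.
case=> e /mx22_inj[-> -> -> ->]; apply/(Aut_triangularP _ _ tr1).
by split; rewrite ?oner_eq0 // !mul0r s0 mulr0 subrr mulr0.
Qed.

End TriangularFamilies.

(** * The remaining algebras *)

Section OtherFamilies.
Variable F : fieldType.
Implicit Types al be : F.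

(** The left and right trace forms are (0, 1) and (1, 0): their invariance alone
    gives both rows of g. *)
Lemma Aut_A1 (al1 al2 al4 be1 : F) : Aut (A1 al1 al2 al4 be1) = [set 1%:M].
Proof.
apply/seteqP; split=> [g | _ ->]; last exact: Aut1.
rewrite (mx22_eta g) /= => gA; move: (Aut_ltrace gA) (Aut_rtrace gA).
move: (g 0 0) (g 0 1) (g 1 0) (g 1 1) => a b c d [c0 d1] [a1 b0].
rewrite mx22_1; congr mx22.
- by apply: (eq_sub_eq a1); ring.
- by apply: (eq_sub_eq b0); ring.
- by apply: (eq_sub_eq c0); ring.
- by apply: (eq_sub_eq d1); ring.
Qed.

Lemma Aut_A12 : Aut (A12 F) =
  [set g | exists a c : F, a != 0 /\ g = mx22 a 0 c (a ^+ 2)].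
Proof.
apply: set22_ext => a b c d; split.
  move=> /Aut_mscP[gU [E11 E21] _ _ _].
  have b0 : b = 0 by apply: (eq_sub_eq E11); ring.
  have d2 : d = a ^+ 2 by apply: (eq_sub_eq E21); ring.
  rewrite b0 mul0r subr0 mulf_eq0 negb_or in gU; case/andP: gU => aN0 _.
  by rewrite b0 d2; exists a, c.
case=> e [f [eN0 /mx22_inj[-> -> -> ->]]].
apply/Aut_mscP; split; last by split; ring.
- by rewrite mul0r subr0 mulf_neq0 ?expf_neq0.
- by split; ring.
- by split; ring.
- by split; ring.
Qed.

Section CharNot2.
Hypothesis two_neq0 : 2 != 0 :> F.

(** After a = 1 and b = 0, the product e^1 e^2 gives d = 1 and 2 * c = 0. *)
Lemma Aut_row0110_id be1 be2 be3 : be2 = 1 \/ be3 = 1 ->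
  Aut (msc 0 1 1 0 be1 be2 be3 (- 1)) = [set 1%:M].
Proof.
move=> tr1; apply/seteqP; split=> [g | _ ->]; last exact: Aut1.
rewrite (mx22_eta g); move: (g 0 0) (g 0 1) (g 1 0) (g 1 1) => a b c d gA.
have [a1 b0] : a = 1 /\ b = 0.
  by apply: Aut_row1 gA; case: tr1 => ->; [left | right]; rewrite add0r subrr.
move: gA; rewrite a1 b0 => /Aut_mscP[_ _ [E12 E22] _ _].
have d1 : d = 1 by apply: (eq_sub_eq (esym E12)); ring.
have /eqP : 2 * c = 0 by rewrite d1 in E22; apply: (eq_sub_eq E22); ring.
by rewrite mulf_eq0 (negPf two_neq0) /= mx22_1 d1 => /eqP->.
Qed.

Lemma Aut_A10 : 3 != 0 :> F ->
  Aut (A10 F) = [set g | exists a : F, a != 0 /\ g = mx22 a 0 0 1].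
Proof.
move=> three_neq0; apply: set22_ext => a b c d; split.
  move=> /Aut_mscP[gU [_ E21] [E12 _] _ [E14 _]].
  have c0 : c = 0.
    by apply/eqP; rewrite -sqrf_eq0; apply/eqP; apply: (eq_sub_eq E21); ring.
  rewrite c0 mulr0 subr0 mulf_eq0 negb_or in gU; case/andP: gU => aN0 _.
  have d1 : d = 1.
    apply: (mulfI aN0); apply: (eq_sub_eq (esym E12)); rewrite c0; ring.
  have /eqP : 3 * b = 0.
    by apply: (eq_sub_eq (esym E14)); rewrite d1; ring.
  by rewrite mulf_eq0 (negPf three_neq0) c0 d1 => /eqP->; exists a.
case=> e [eN0 /mx22_inj[-> -> -> ->]].
by apply/Aut_mscP; split; [rewrite mulr1 mul0r subr0 | split; ring..].
Qed.

Let four_neq0 : 4 != 0 :> F.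
Proof. by rewrite (_ : 4 = 2 * 2) ?mulf_neq0 //; ring. Qed.

(** The first coordinate of g (e^2 e^2) gives b * (2 * d + 1) = 0, which splits
    the group into the stabiliser of the line through e^2 (the case b = 0) and
    the other elements, all of which have d = - 1 / 2. *)
Lemma Aut_A11P a b c d : Aut (A11 F) (mx22 a b c d) <->
  [/\ a ^+ 2 = 1, b = 0, c = 0 & d = 1] \/
  [/\ a ^+ 2 = 1 / 4, b ^+ 2 = 3 / 4, c = 2 * a * b & d = - (1 / 2)].
Proof.
split=> [/Aut_mscP[gU [E11 E21] [_ E22] _ [E14 E24]] | ].
  have [b0 | bN0] := eqVneq b 0; [left | right].
    rewrite {}b0 mul0r subr0 mulf_eq0 negb_or in gU E22 E24 E21 *.
    case/andP: gU => _ dN0.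
    have d1 : d = 1.
      by apply: (mulfI dN0); apply: (eq_sub_eq E24); ring.
    have c0 : c = 0.
      apply: (mulfI two_neq0); rewrite d1 in E22.
      by apply: (eq_sub_eq E22); ring.
    split=> //; rewrite d1 c0 in E21.
    by apply: (eq_sub_eq (esym E21)); ring.
  have d12 : d = - (1 / 2).
    apply: (mulfI bN0); apply: (mulfI two_neq0).
    by apply: (eq_sub_eq (esym E14)); field.
  have c2ab : c = 2 * a * b.
    rewrite d12 in E22; apply: (mulfI two_neq0).
    by apply: (eq_sub_eq (congr1 ( *%R 4) E22)); field.
  split=> //.
    apply: (mulfI bN0); rewrite c2ab in E11; apply: (mulfI four_neq0).
    by apply: (eq_sub_eq (esym E11)); field.
  by rewrite d12 in E24; apply: (eq_sub_eq (esym E24)); field; apply/andP.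
case=> [[a2 -> -> ->] | [a2 b2 -> ->]]; apply/Aut_mscP.
  split; [|by split; ring: a2..].
  by rewrite mulr1 mul0r subr0 -sqrf_eq0 a2 oner_eq0.
split; [|split..].
- (* the determinant is - 2 * a, and a is nonzero since 4 * a ^+ 2 = 1 *)
  have -> : a * - (1 / 2) - b * (2 * a * b) = - (2 * a).
    by apply: (eq_sub_eq (congr1 ( *%R (- (2 * a))) b2)); field; apply/andP.
  by rewrite oppr_eq0 mulf_neq0 // -sqrf_eq0 a2 mul1r invr_eq0.
- by apply: (eq_sub_eq (congr1 ( *%R (- (4 * b))) a2)); field.
- apply: (eq_sub_eq (congr2 +%R (congr1 ( *%R (4 * a ^+ 2)) b2)
                                (congr1 ( *%R 2) a2))).
  by field; apply/andP.
- by apply: (eq_sub_eq (congr1 ( *%R (- (2 * a))) b2)); field; apply/andP.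
- by field.
- by apply: (eq_sub_eq (congr1 ( *%R (- (2 * a))) b2)); field; apply/andP.
- by field.
- by field.
- by apply: (eq_sub_eq (esym b2)); field; apply/andP.
Qed.

Lemma Aut_A11 (r : F) : r ^+ 2 = 3 ->
  Aut (A11 F) =
    [set 1%:M;
         mx22 (- 1) 0
              0     1;
         mx22 (1 / 2)     (r / 2)
              (r / 2) (- (1 / 2));
         mx22 (1 / 2)         (- (r / 2))
              (- (r / 2)) (- (1 / 2));
         mx22 (- (1 / 2))     (r / 2)
              (- (r / 2)) (- (1 / 2));
         mx22 (- (1 / 2)) (- (r / 2))
              (r / 2) (- (1 / 2))].
Proof.
move=> r2; rewrite mx22_1.
have half2 (x : F) : 2 * (1 / 2) * x = x by field.
have half_sq : (1 / 2) ^+ 2 = 1 / 4 :> F by field; apply/andP.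
have r_half_sq : (r / 2) ^+ 2 = 3 / 4.
  by rewrite expr_div_n r2; congr (_ / _); ring.
apply: set22_ext => a b c d; split.
  move=> /Aut_A11P[[/eqP + -> -> ->] | [/eqP + /eqP + -> ->]].
    by rewrite sqrf_eq1 => /orP[] /eqP ->; do 4 left; [left | right].
  rewrite -half_sq -r_half_sq !eqf_sqr.
  case/orP=> /eqP -> /orP[] /eqP ->; rewrite ?(mulrN, mulNr) half2 ?opprK.
  - by do 3 left; right.
  - by do 2 left; right.
  - by left; right.
  - by right.
case=> [[[[[]|]|]|]|] /mx22_inj[-> -> -> ->]; apply/Aut_A11P;
  by [left; split; rewrite ?sqrrN ?expr1n
     | right; split; rewrite ?sqrrN // ?(mulrN, mulNr) half2 ?opprK].
Qed.

End CharNot2.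
End OtherFamilies.

(** * The automorphism groups *)

Theorem theorem3p1 (F : closedFieldType)
    (char2 : 2%N \notin [pchar F]) (char3 : 3%N \notin [pchar F]) :
  (forall al1 al2 al4 be1 : F, Aut (A1 al1 al2 al4 be1) = [set 1%:M]) /\
  (forall al1 be1 be2 : F, be1 != 0 -> Aut (A2 al1 be1 be2) = [set 1%:M]) /\
  (forall al1 be2 : F,
     Aut (A2 al1 0 be2) = [set 1%:M; mx22 1 0 0 (- 1)]) /\
  (forall be1 be2 : F, Aut (A3 be1 be2) = [set 1%:M]) /\
  (forall al1 be2 : F, be2 != 2 * al1 - 1 ->
     Aut (A4 al1 be2) = [set g | exists d : F, d != 0 /\ g = mx22 1 0 0 d]) /\
  (forall al1 : F,
     Aut (A4 al1 (2 * al1 - 1)) =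
       [set g | exists c d : F, d != 0 /\ g = mx22 1 0 c d]) /\
  (forall al1 : F,
     Aut (A5 al1) = [set g | exists c : F, g = mx22 1 0 c 1]) /\
  (forall al1 be1 : F, be1 != 0 -> Aut (A6 al1 be1) = [set 1%:M]) /\
  (forall al1 : F, Aut (A6 al1 0) = [set 1%:M; mx22 1 0 0 (- 1)]) /\
  (forall be1 : F, Aut (A7 be1) = [set 1%:M]) /\
  (forall al1 : F, al1 != 1 / 3 ->
     Aut (A8 al1) = [set g | exists d : F, d != 0 /\ g = mx22 1 0 0 d]) /\
  Aut (A8 (1 / 3 : F)) =
    [set g | exists c d : F, d != 0 /\ g = mx22 1 0 c d] /\
  Aut (A9 F) = [set g | exists c : F, g = mx22 1 0 c 1] /\
  Aut (A10 F) = [set g | exists a : F, a != 0 /\ g = mx22 a 0 0 1] /\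
  (forall sqrt3 : F, sqrt3 ^+ 2 = 3 ->
     Aut (A11 F) =
       [set 1%:M;
            mx22 (- 1) 0
                 0     1;
            mx22 (1 / 2)     (sqrt3 / 2)
                 (sqrt3 / 2) (- (1 / 2));
            mx22 (1 / 2)         (- (sqrt3 / 2))
                 (- (sqrt3 / 2)) (- (1 / 2));
            mx22 (- (1 / 2))     (sqrt3 / 2)
                 (- (sqrt3 / 2)) (- (1 / 2));
            mx22 (- (1 / 2)) (- (sqrt3 / 2))
                 (sqrt3 / 2) (- (1 / 2))]) /\
  Aut (A12 F) = [set g | exists a c : F, a != 0 /\ g = mx22 a 0 c (a ^+ 2)].
Proof.
have two_neq0 : 2 != 0 :> F by move: char2; rewrite inE /=.
have three_neq0 : 3 != 0 :> F by move: char3; rewrite inE /=.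
have tr1r (x : F) : x + (1 - x) = 1 by rewrite addrC subrK.
split; first exact: Aut_A1.
split=> [al1 be1 be2 be1N0|]; first by apply: Aut_triangular_id; [right|].
split=> [al1 be2|]; first by apply: Aut_triangular_sign; right.
split=> [be1 be2|]; first by apply: Aut_row0110_id; [|right].
split=> [al1 be2 neq|].
  apply: Aut_triangular_diag; first by right.
  apply: contraNneq neq => sum_be; apply/eqP.
  by apply: (eq_sub_eq sum_be); ring.
split=> [al1|].
  by apply: Aut_triangular_full; [right | ring].
split=> [al1|].
  by apply: Aut_triangular_unipotent; [right | ring].
split=> [al1 be1 be1N0|]; first by apply: Aut_triangular_id; [left|].
split=> [al1|]; first by apply: Aut_triangular_sign; left.
split=> [be1|]; first by apply: Aut_row0110_id; [|left].
split=> [al1 neq|].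
  apply: Aut_triangular_diag; first by left.
  apply: contraNneq neq => sum_be; apply/eqP; apply: (mulfI three_neq0).
  by apply: (eq_sub_eq (esym sum_be)); field.
split; first by apply: Aut_triangular_full; [left | field].
split; first by apply: Aut_triangular_unipotent; [left | ]; field.
split; first exact: Aut_A10.
split=> [r r2|]; last exact: Aut_A12.
exact: Aut_A11.
Qed.
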